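(* Let $p$ be a prime number and let $f(t)=\sum_{0\le i\le l}a_it^{d-i}=a_0t^{d-l}\prod_{1\le i\le l}(t-\alpha_i)\in\mathbb{C}_p[t^{\pm1}]$ with $d\in\mathbb{Z}$, $l\in\mathbb{Z}_{\ge0}$, $a_i,\alpha_i\in\mathbb{C}_p$ and $a_0a_l\neq0$. Suppose that $f(t)$ has no root on $\{z\in\mathbb{C}_p : |z|_p=1\}$. Then the $p$-adic Mahler measure $M_p(f(t))$ (the limit defining it exists and) satisfies $$\log M_p(f(t))=\log|a_l|_p-\sum_{0<|\alpha_i|_p<1}\log|\alpha_i|_p=\log|a_0|_p+\sum_{|\alpha_i|_p>1}\log|\alpha_i|_p .$$
   Context: $\mathbb{C}_p$ is the $p$-adic completion of an algebraic closure of $\mathbb{Q}_p$, with $p$-adic absolute value $|\cdot|_p$ normalized by $|p|_p=p^{-1}$. For a nonzero Laurent polynomial $f(t)\in\mathbb{C}_p[t^{\pm1}]$ with no root on $|z|_p=1$, the $p$-adic Mahler measure $M_p(f(t))$ is defined by $$\log M_p(f(t))=\lim_{n\to\infty,\ \gcd(n,p)=1}\frac1n\sum_{\zeta^n=1}\log|f(\zeta)|_p,$$ where $n$ runs over positive integers prime to $p$, $\zeta$ runs over the $n$-th roots of unity in $\mathbb{C}_p$, $\log$ is the real logarithm, and the limit is taken with respect to the Euclidean topology on $\mathbb{R}$. *)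

(* Defs.v *)
From HB Require Import structures.
From mathcomp Require Import all_boot all_order all_algebra.
From mathcomp Require Import all_classical all_reals all_analysis.

Set Implicit Arguments.
Unset Strict Implicit.
Unset Printing Implicit Defensive.

Import Order.TTheory GRing.Theory Num.Theory.
Import numFieldNormedType.Exports.
Local Open Scope classical_set_scope.
Local Open Scope ring_scope.

Section Valued.
Variable R : realType.

Definition padic_abs (p : nat) (x : rat) : R :=
  if x == 0 then 0
  else p%:R ^ ((logn p `|denq x|%N)%:Z - (logn p `|numq x|%N)%:Z).

Record nonarch_abs (K : fieldType) (v : K -> R) : Prop := {
  nonarch_abs_ge0 : forall x, 0 <= v x;
  nonarch_abs_eq0 : forall x, v x = 0 <-> x = 0;
  nonarch_absM : forall x y, v (x * y) = v x * v y;
  nonarch_absD : forall x y, v (x + y) <= Num.max (v x) (v y) }.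

Definition abs_cauchy (K : fieldType) (v : K -> R) (u : nat -> K) : Prop :=
  forall e : R, 0 < e ->
    exists N, forall m n, (N <= m)%N -> (N <= n)%N -> v (u m - u n) < e.

Definition abs_complete (K : fieldType) (v : K -> R) : Prop :=
  forall u, abs_cauchy v u -> exists l, (fun n => v (u n - l)) @ \oo --> (0 : R).

Record is_completion (K L : fieldType) (v : K -> R) (w : L -> R)
    (iota : {rmorphism K -> L}) : Prop := {
  completion_abs : nonarch_abs w;
  completion_isometry : forall x, w (iota x) = v x;
  completion_dense : forall y (e : R), 0 < e -> exists x, w (y - iota x) < e;
  completion_complete : abs_complete w }.

Definition is_algebraic_closure (K : fieldType) (L : closedFieldType)
    (iota : {rmorphism K -> L}) : Prop :=
  forall x : L, algebraicOver iota x.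

(* [is_Cp p v] : the field [C] with the absolute value [v] is C_p, i.e. the
   completion of an algebraic closure [Qpbar] of [Qp], where [Qp] is the
   completion of [rat] for the p-adic absolute value and [Qpbar] carries an
   absolute value extending the one of [Qp].  These conditions determine
   [C] and [v] up to isometric isomorphism. *)
Definition is_Cp (p : nat) (C : fieldType) (v : C -> R) : Prop :=
  exists (Qp : fieldType) (vQp : Qp -> R) (i : {rmorphism rat -> Qp})
         (Qpbar : closedFieldType) (vQpbar : Qpbar -> R)
         (j : {rmorphism Qp -> Qpbar}) (k : {rmorphism Qpbar -> C}),
    [/\ is_completion (padic_abs p) vQp i,
        is_algebraic_closure j,
        nonarch_abs vQpbar,
        forall x, vQpbar (j x) = vQp x &
        is_completion vQpbar v k].

End Valued.

(* The ring K[t, t^-1] is the subring of the fraction field K(t) of K[t]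
   consisting of the fractions P / t^n. *)
Section Laurent.
Variable K : fieldType.

Definition laurent_pred : {pred {fraction {poly K}}} :=
  fun f => `[< exists nP : nat * {poly K},
                 f * tofrac 'X ^+ nP.1 = tofrac nP.2 >].

Lemma tofracX_neq0 : tofrac 'X != 0 :> {fraction {poly K}}.
Proof. by rewrite tofrac_eq0 polyX_eq0. Qed.

Lemma laurent_subring : subring_closed laurent_pred.
Proof.
split.
- by apply/asboolP; exists (0%N, 1); rewrite /= expr0 mulr1 tofrac1.
- move=> f g /asboolP[[n P] /= fP] /asboolP[[m Q] /= gQ].
  apply/asboolP; exists ((n + m)%N, P * 'X^m - Q * 'X^n) => /=.
  rewrite tofracB !tofracM !tofracXn -fP -gQ exprD mulrBl.
  by rewrite mulrA; congr (_ - _); rewrite -!mulrA [X in g * X]mulrC.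
- move=> f g /asboolP[[n P] /= fP] /asboolP[[m Q] /= gQ].
  apply/asboolP; exists ((n + m)%N, P * Q) => /=.
  by rewrite tofracM -fP -gQ exprD mulrACA.
Qed.

HB.instance Definition _ :=
  GRing.isSubringClosed.Build {fraction {poly K}} laurent_pred laurent_subring.

Record laurent := Laurent {
  laurent_val : {fraction {poly K}};
  laurent_valP : laurent_val \in laurent_pred }.

HB.instance Definition _ := [isSub for laurent_val].
HB.instance Definition _ := [Choice of laurent by <:].
HB.instance Definition _ := [SubChoice_isSubComNzRing of laurent by <:].

Lemma laurentC_subproof (c : K) : tofrac c%:P \in laurent_pred.
Proof. by apply/asboolP; exists (0%N, c%:P); rewrite /= expr0 mulr1. Qed.

Definition laurentC (c : K) : laurent := Laurent (laurentC_subproof c).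

Lemma tpow_subproof (k : int) : tofrac 'X ^ k \in laurent_pred.
Proof.
apply/asboolP; case: k => n.
- by exists (0%N, 'X^n); rewrite /= expr0 mulr1 tofracXn.
- exists (n.+1, 1); rewrite /= tofrac1 mulVf //.
  by rewrite expf_neq0 ?tofracX_neq0.
Qed.

Definition tpow (k : int) : laurent := Laurent (tpow_subproof k).

Lemma laurent_repr (f : laurent) :
  exists nP : nat * {poly K}, val f * tofrac 'X ^+ nP.1 = tofrac nP.2.
Proof. exact/asboolP/laurent_valP. Qed.

(* The value at z <> 0 does not depend on the chosen expression P / t^n of f,
   see [laurent_evalE]. *)
Definition laurent_eval (f : laurent) (z : K) : K :=
  let nP := projT1 (cid (laurent_repr f)) in nP.2.[z] / z ^+ nP.1.

Lemma laurent_evalE (f : laurent) n P z : z != 0 ->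
  val f * tofrac 'X ^+ n = tofrac P -> laurent_eval f z = P.[z] / z ^+ n.
Proof.
move=> z0 fP; rewrite /laurent_eval; case: cid => -[m Q] /= fQ.
have PQ : Q * 'X^n = P * 'X^m.
  by apply/eqP; rewrite -tofrac_eq; apply/eqP; rewrite !tofracM !tofracXn -fP -fQ mulrAC.
have /(congr1 (horner^~ z)) := PQ; rewrite !hornerM !hornerXn => e.
by apply/eqP; rewrite eqr_div ?expf_neq0// e.
Qed.

Lemma laurent_evalC c z : z != 0 -> laurent_eval (laurentC c) z = c.
Proof.
move=> z0; rewrite (@laurent_evalE _ 0 c%:P) ?expr0 ?mulr1 //.
by rewrite hornerC divr1.
Qed.

Lemma laurent_eval_tpow k z : z != 0 -> laurent_eval (tpow k) z = z ^ k.
Proof.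
move=> z0; case: k => n.
- rewrite (@laurent_evalE _ 0 'X^n) ?expr0 ?mulr1 ?tofracXn //.
  by rewrite hornerXn divr1.
- rewrite (@laurent_evalE _ n.+1 1) //=; first by rewrite hornerC div1r.
  by rewrite tofrac1 mulVf // expf_neq0 ?tofracX_neq0.
Qed.

Lemma laurent_evalD f g z : z != 0 ->
  laurent_eval (f + g) z = laurent_eval f z + laurent_eval g z.
Proof.
move=> z0; have [[n P] /= fP] := laurent_repr f.
have [[m Q] /= gQ] := laurent_repr g.
rewrite (laurent_evalE z0 fP) (laurent_evalE z0 gQ).
rewrite (@laurent_evalE _ (n + m) (P * 'X^m + Q * 'X^n)) //=.
  by rewrite hornerD !hornerM !hornerXn addf_div ?expf_neq0// -exprD.
rewrite tofracD !tofracM !tofracXn -fP -gQ exprD mulrDl.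
by rewrite mulrA; congr (_ + _); rewrite -!mulrA [X in _ * X = _]mulrC.
Qed.

Lemma laurent_evalM f g z : z != 0 ->
  laurent_eval (f * g) z = laurent_eval f z * laurent_eval g z.
Proof.
move=> z0; have [[n P] /= fP] := laurent_repr f.
have [[m Q] /= gQ] := laurent_repr g.
rewrite (laurent_evalE z0 fP) (laurent_evalE z0 gQ).
rewrite (@laurent_evalE _ (n + m) (P * Q)) //=.
  by rewrite hornerM mulf_div -exprD.
by rewrite tofracM -fP -gQ exprD mulrACA.
Qed.

End Laurent.

Section Mahler.
Variables (R : realType) (p : nat) (C : fieldType) (v : C -> R).

Definition mahler_mean (f : laurent C) (n : nat) : R :=
  n%:R^-1 * \sum_(z \in [set z : C | z ^+ n = 1]) ln (v (laurent_eval f z)).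

Definition coprime_infty : set_system nat :=
  within [set n | coprime n p] \oo.

Definition padic_mahler (f : laurent C) : R :=
  expR (lim (mahler_mean f @ coprime_infty)).

End Mahler.

(* Main.v *)
(* For [|z| = 1] and [|alpha| != 1] the ultrametric inequality forces
   [|z - alpha| = max 1 |alpha|].  Since [f] has no root on the unit circle, all
   [|alpha_i| != 1], hence [|f z|] is the same for every root of unity [z] and the
   means defining [M_p f] do not depend on [n]: there are exactly [n] roots of unity
   of order dividing [n] in [C_p].  The two formulas agree because
   [a_l = a_0 * prod_i (- alpha_i)]. *)
Require Import Defs.
From mathcomp Require Import all_boot all_order all_algebra.
From mathcomp Require Import separable cyclotomic.
From mathcomp Require Import all_classical all_reals all_analysis.
Set Implicit Arguments.
Unset Strict Implicit.

Import Order.TTheory GRing.Theory Num.Theory.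
Import numFieldNormedType.Exports.
Local Open Scope classical_set_scope.
Local Open Scope ring_scope.

(** As [n] is invertible in [L], ['X^n - 1] is separable, so the linear factors into which it splits
    are pairwise distinct. *)
Lemma closed_field_unity_roots (L : closedFieldType) (n : nat) :
  n%:R != 0 :> L ->
  exists s : seq L, [/\ uniq s, size s = n & all n.-unity_root s].
Proof.
move=> n0; have n_gt0 : (0 < n)%N by case: n n0; rewrite ?eqxx.
have [s] := closed_field_poly_normal ('X^n - 1 : {poly L}).
rewrite lead_coefXnsubC // scale1r => Es; exists s; split.
- by rewrite -separable_prod_XsubC -Es separable_Xn_sub_1.
- by apply: succn_inj; rewrite -(size_prod_XsubC s id) -Es size_XnsubC.
- by apply/allP => z zs; rewrite /root_of_unity Es root_prod_XsubC.
Qed.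

Section NonArchimedean.
Context {R : realType} {K : fieldType} {v : K -> R}.
Hypothesis vP : nonarch_abs v.

Lemma nonarch_abs0 : v 0 = 0.
Proof. exact/(nonarch_abs_eq0 vP). Qed.

Lemma nonarch_abs_gt0 (x : K) : (0 < v x) = (x != 0).
Proof.
rewrite lt0r (nonarch_abs_ge0 vP) andbT; congr negb.
by apply/eqP/eqP => /(nonarch_abs_eq0 vP).
Qed.

Lemma nonarch_abs1 : v 1 = 1.
Proof.
have v1 : v 1 != 0 by rewrite gt_eqF // nonarch_abs_gt0 oner_neq0.
by apply: (mulfI v1); rewrite -(nonarch_absM vP) !mulr1.
Qed.

Lemma nonarch_absX (x : K) (n : nat) : v (x ^+ n) = v x ^+ n.
Proof.
elim: n => [|n IH]; first by rewrite !expr0 nonarch_abs1.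
by rewrite !exprS (nonarch_absM vP) IH.
Qed.

Lemma nonarch_abs_unity (z : K) (n : nat) :
  (0 < n)%N -> z ^+ n = 1 -> v z = 1.
Proof.
move=> n0 /(congr1 v); rewrite nonarch_absX nonarch_abs1 => /eqP.
by rewrite pexpr_eq1 // ?(nonarch_abs_ge0 vP) // => /eqP.
Qed.

(** Since [(-1) ^+ 2 = 1], [-1] is a root of unity and has absolute value 1. *)
Lemma nonarch_absN (x : K) : v (- x) = v x.
Proof.
by rewrite -mulN1r (nonarch_absM vP) (@nonarch_abs_unity (-1) 2) ?mul1r ?sqrrN ?expr1n.
Qed.

Lemma nonarch_absV (x : K) : v x^-1 = (v x)^-1.
Proof.
have [->|x0] := eqVneq x 0; first by rewrite invr0 nonarch_abs0 invr0.
have vx : v x != 0 by rewrite gt_eqF // nonarch_abs_gt0.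
by apply: (mulfI vx); rewrite -(nonarch_absM vP) !divff // nonarch_abs1.
Qed.

Lemma nonarch_absXz (x : K) (k : int) : v (x ^ k) = v x ^ k.
Proof.
case: k => n; first exact: nonarch_absX.
by rewrite /exprz nonarch_absV nonarch_absX.
Qed.

Lemma nonarch_abs_prod (I : finType) (F : I -> K) :
  v (\prod_i F i) = \prod_i v (F i).
Proof. exact: (big_morph v (nonarch_absM vP) nonarch_abs1). Qed.

Lemma nonarch_absB_lt (x y : K) : v y < v x -> v (x - y) = v x.
Proof.
move=> yx; apply/eqP; rewrite eq_le; apply/andP; split.
  by rewrite (le_trans (nonarch_absD vP _ _)) // nonarch_absN ge_max lexx ltW.
(* Lower bound: in [x = (x - y) + y] the summand [y] is too small to account for [v x]. *)
have := nonarch_absD vP (x - y) y; rewrite subrK le_max => /orP[//|].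
by rewrite leNgt yx.
Qed.

Lemma nonarch_absB_max (x y : K) :
  v x != v y -> v (x - y) = Num.max (v x) (v y).
Proof.
rewrite neq_lt => /orP[] xy; last by rewrite nonarch_absB_lt ?(max_idPl (ltW xy)).
by rewrite -opprB nonarch_absN nonarch_absB_lt ?(max_idPr (ltW xy)).
Qed.

End NonArchimedean.

Lemma ln_prod (R : realType) (I : finType) (F : I -> R) :
  (forall i, 0 < F i) -> ln (\prod_i F i) = \sum_i ln (F i).
Proof.
move=> F0; suff [_ ->] : 0 < \prod_i F i /\ ln (\prod_i F i) = \sum_i ln (F i) by [].
elim/big_rec2: _ => [|i y x _ [y0 <-]]; first by rewrite ln1.
by rewrite lnM ?posrE //; split=> //; apply: mulr_gt0.
Qed.

(** The roots are found in the algebraically closed field [L], of characteristic 0 because it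
    receives a morphism from [rat]. The injective [k] carries them to [n] distinct roots in [C], and
    a field has no more than [n]. *)
Lemma Cp_unity_roots (R : realType) (p : nat) (C : fieldType) (v : C -> R)
    (n : nat) : is_Cp p v -> (0 < n)%N ->
  exists s : seq C,
    [/\ uniq s, size s = n & [set z : C | z ^+ n = 1] = [set` s]].
Proof.
move=> [Qp [vQp [i [L [vL [j [k _]]]]]]] n0.
have nL : n%:R != 0 :> L.
  by rewrite -(rmorph_nat j) -(rmorph_nat i) !fmorph_eq0 pnatr_eq0 -lt0n.
have [s [us ss Hs]] := closed_field_unity_roots nL.
have uks : uniq (map k s) by rewrite map_inj_uniq //; exact: fmorph_inj.
have sks : size (map k s) = n by rewrite size_map.
exists (map k s); split=> //.
have Hks : all n.-unity_root (map k s).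
  apply/allP => _ /mapP[z /(allP Hs) zn ->].
  by move: zn; rewrite !unity_rootE -rmorphXn fmorph_eq1.
apply/seteqP; split=> z /=;
  by rewrite -(mem_unity_roots n0 Hks uks sks) -topredE /= unity_rootE => /eqP.
Qed.

Lemma mahler_mean_cst (R : realType) (p : nat) (C : fieldType) (v : C -> R)
    (f : laurent C) (c : R) (n : nat) : is_Cp p v -> (0 < n)%N ->
  (forall z, z ^+ n = 1 -> ln (v (laurent_eval f z)) = c) ->
  mahler_mean v f n = c.
Proof.
move=> CpP n0 fc; have [s [us ss Es]] := Cp_unity_roots CpP n0.
rewrite /mahler_mean Es -fsbig_seq //.
rewrite (eq_big_seq (fun=> c)); last first.
  by move=> z zs; apply: fc; have : [set` s] z by []; rewrite -Es.
rewrite big_const_seq count_predT ss iter_addr addr0 -[c *+ n]mulr_natl mulKf //.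
by rewrite pnatr_eq0 -lt0n.
Qed.

Lemma coprime_infty_proper (p : nat) : (0 < p)%N -> ProperFilter (coprime_infty p).
Proof.
move=> p0; split; last exact: within_filter.
(* The witness [N * p + 1] is at least [N] and congruent to 1 modulo [p]. *)
move=> [N _ /(_ (N * p).+1)] /=; apply.
  by rewrite (leq_trans (leq_pmulr N p0)).
by rewrite -addn1 -coprime_modl modnMDl coprime_modl coprime1n.
Qed.

Lemma cvg_mahler_mean_cst (R : realType) (p : nat) (C : fieldType) (v : C -> R)
    (f : laurent C) (c : R) : is_Cp p v ->
  (forall (n : nat) z, (0 < n)%N -> z ^+ n = 1 ->
     ln (v (laurent_eval f z)) = c) ->
  mahler_mean v f @ coprime_infty p --> c.
Proof.
move=> CpP fc; have FF : Filter (coprime_infty p) by exact: within_filter.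
(* Starting at 1 excludes [n = 0], where [z ^+ n = 1] holds for every [z]. *)
apply: cvg_near_cst; exists 1%N => // n n0 _.
by apply: (mahler_mean_cst CpP n0) => z; apply: fc.
Qed.

Section LaurentFactorization.
Variables (K : fieldType) (d : int) (l : nat) (a0 : K) (alpha : 'I_l -> K).
Let g : laurent K := laurentC a0 * tpow K (d - l%:Z) *
                       \prod_(i < l) (tpow K 1 - laurentC (alpha i)).

Lemma laurent_eval_factored (z : K) : z != 0 ->
  laurent_eval g z = a0 * z ^ (d - l%:Z) * \prod_(i < l) (z - alpha i).
Proof.
move=> z0; rewrite !laurent_evalM // laurent_evalC // laurent_eval_tpow //.
congr (_ * _); have eval1 : laurent_eval 1 z = 1.
  by rewrite (@laurent_evalE _ _ 0 1) ?expr0 ?mulr1 ?tofrac1 // hornerC divr1.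
rewrite (big_morph (fun h => laurent_eval h z)
           (fun x y => laurent_evalM x y z0) eval1).
apply: eq_bigr => i _.
have -> : tpow K 1 - laurentC (alpha i) = tpow K 1 + laurentC (- alpha i).
  by congr (_ + _); apply: val_inj; rewrite rmorphN /= polyCN tofracN.
by rewrite laurent_evalD // laurent_evalC // laurent_eval_tpow // expr1z.
Qed.

(** Multiplied by [t^(l-d)], both expressions of [g] become polynomials in [t]. Comparing their
    values at 0 gives the claim; [laurent_eval] is meaningful only away from 0, hence the passage to
    [{poly K}]. *)
Lemma laurent_factored_constant_coef (a : 'I_l.+1 -> K) :
  \sum_(i < l.+1) laurentC (a i) * tpow K (d - i%:Z) = g ->
  a ord_max = a0 * \prod_(i < l) - alpha i.
Proof.
move=> /(congr1 val); rewrite /g !rmorphM rmorph_sum rmorph_prod.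
move=> /(congr1 (GRing.mul (tofrac 'X ^ (l%:Z - d)))).
have X0 := tofracX_neq0 K.
have Xlk k : (k <= l)%N -> tofrac 'X ^ (l%:Z - d) * tofrac 'X ^ (d - k%:Z)
    = tofrac 'X^(l - k) :> {fraction {poly K}}.
  by move=> kl; rewrite -expfzDr // addrA subrK subzn // tofracXn.
have -> : tofrac 'X ^ (l%:Z - d) *
    \sum_(i < l.+1) val (laurentC (a i) * tpow K (d - i%:Z)) =
    tofrac (\sum_(i < l.+1) (a i)%:P * 'X^(l - i)).
  rewrite mulr_sumr rmorph_sum; apply: eq_bigr => i _.
  by rewrite !rmorphM /= mulrCA Xlk // -ltnS.
have -> : tofrac 'X ^ (l%:Z - d) *
    (tofrac a0%:P * tofrac 'X ^ (d - l%:Z) *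
     \prod_(i < l) val (tpow K 1 - laurentC (alpha i))) =
    tofrac (a0%:P * \prod_(i < l) ('X - (alpha i)%:P)).
  rewrite mulrA mulrCA Xlk // subnn expr0 tofrac1 mulr1 tofracM rmorph_prod.
  congr (_ * _); apply: eq_bigr => i _.
  by rewrite rmorphB /= expr1z tofracB.
move=> /eqP; rewrite tofrac_eq => /eqP/(congr1 (horner^~ 0)).
rewrite horner_sum hornerM hornerC horner_prod.
under [in RHS]eq_bigr => i _ do rewrite hornerXsubC sub0r.
(* At 0 the factor ['X^(l - i)] vanishes unless [i = l], so only the last term survives. *)
move=> <-; rewrite big_ord_recr /= big1 ?add0r => [|i _].
  by rewrite subnn expr0 mulr1 hornerC.
by rewrite hornerM hornerXn expr0n subn_eq0 leqNgt ltn_ord mulr0.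
Qed.

End LaurentFactorization.

Theorem theorem2p3 (R : realType) (p : nat) (p_prime : prime p)
    (Cp : fieldType) (abs : Cp -> R) (Cp_abs : is_Cp p abs)
    (d : int) (l : nat) (a : 'I_l.+1 -> Cp) (alpha : 'I_l -> Cp)
    (f : laurent Cp)
    (f_sum : f = \sum_(i < l.+1) laurentC (a i) * tpow Cp (d - i%:Z))
    (f_prod : f = laurentC (a ord0) * tpow Cp (d - l%:Z) *
                  \prod_(i < l) (tpow Cp 1 - laurentC (alpha i)))
    (a_neq0 : a ord0 * a ord_max <> 0)
    (f_noroot : forall z : Cp, abs z = 1 -> laurent_eval f z <> 0) :
  [/\ cvg (mahler_mean abs f @ coprime_infty p),
      ln (padic_mahler p abs f) =
        ln (abs (a ord_max)) -
        \sum_(i < l | 0 < abs (alpha i) < 1) ln (abs (alpha i)) &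
      ln (abs (a ord_max)) -
        \sum_(i < l | 0 < abs (alpha i) < 1) ln (abs (alpha i)) =
      ln (abs (a ord0)) +
        \sum_(i < l | 1 < abs (alpha i)) ln (abs (alpha i))].
Proof.
have vP : nonarch_abs abs.
  by have [? [? [? [? [? [? [? [_ _ _ _ []]]]]]]]] := Cp_abs.
have v_neq0 z : abs z = 1 -> z != 0.
  by move=> z1; rewrite -(nonarch_abs_gt0 vP) z1.
have alpha1 i : abs (alpha i) != 1.
  apply/eqP => ai1; apply: (f_noroot _ ai1).
  rewrite f_prod laurent_eval_factored ?v_neq0 //.
  by rewrite (bigD1 i) //= subrr mul0r mulr0.
have aE : a ord_max = a ord0 * \prod_(i < l) - alpha i.
  by apply: (laurent_factored_constant_coef (d := d)); rewrite -f_sum.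
(* A zero [alpha i] would make [a ord_max] vanish, by [aE]. *)
have [a00 alpha0] : a ord0 != 0 /\ forall i, 0 < abs (alpha i).
  move/eqP: a_neq0; rewrite aE !mulf_eq0 !negb_or => /and3P[a00 _ /prodf_neq0 a_].
  by split=> // i; rewrite (nonarch_abs_gt0 vP) -oppr_eq0 a_.
have la0 : 0 < abs (a ord0) by rewrite (nonarch_abs_gt0 vP).
have f_cst (n : nat) z : (0 < n)%N -> z ^+ n = 1 ->
    ln (abs (laurent_eval f z)) =
    ln (abs (a ord0)) + \sum_(i < l | 1 < abs (alpha i)) ln (abs (alpha i)).
  move=> n0 /(nonarch_abs_unity vP n0) z1.
  rewrite f_prod laurent_eval_factored ?v_neq0 // !(nonarch_absM vP).
  rewrite (nonarch_absXz vP) z1 exp1rz mulr1 (nonarch_abs_prod vP).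
  have zB i : abs (z - alpha i) = Num.max 1 (abs (alpha i)).
    by rewrite (nonarch_absB_max vP) z1 // eq_sym.
  under eq_bigr => i _ do rewrite zB.
  have max0 i : 0 < Num.max 1 (abs (alpha i)) by rewrite lt_max ltr01.
  rewrite lnM ?posrE ?prodr_gt0 // ln_prod //; congr (_ + _).
  (* Factors with [abs (alpha i) <= 1] have maximum 1 and contribute [ln 1 = 0]. *)
  rewrite [RHS]big_mkcond; apply: eq_bigr => i _.
  by case: ltP => _; rewrite ?ln1.
have eq_sides : ln (abs (a ord_max)) -
      \sum_(i < l | 0 < abs (alpha i) < 1) ln (abs (alpha i)) =
    ln (abs (a ord0)) + \sum_(i < l | 1 < abs (alpha i)) ln (abs (alpha i)).
  rewrite aE (nonarch_absM vP) (nonarch_abs_prod vP).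
  under eq_bigr => i _ do rewrite (nonarch_absN vP).
  rewrite lnM ?posrE ?prodr_gt0 // ln_prod // -addrA; congr (_ + _).
  (* The sum over all [i] is split at 1. Absolute values 0 and 1 being excluded by [alpha0] and
     [alpha1], the complement of [1 < abs (alpha i)] is exactly [0 < abs (alpha i) < 1]. *)
  apply/eqP; rewrite subr_eq [X in X == _](bigID (fun i => 1 < abs (alpha i))) /=.
  apply/eqP; congr (_ + _); apply: eq_bigl => i.
  by rewrite alpha0 -leNgt le_eqVlt (negPf (alpha1 i)).
have cvgM := cvg_mahler_mean_cst Cp_abs f_cst.
(* Along a proper filter limits in a Hausdorff space are unique, so the [lim] in [padic_mahler] is
   the constant value of the means. *)
have FP : ProperFilter (coprime_infty p) by apply/coprime_infty_proper/prime_gt0.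
rewrite eq_sides /padic_mahler expRK; split=> //.
  by apply/cvg_ex; eexists; exact: cvgM.
by apply: cvg_lim => //; exact: norm_hausdorff.
Qed.
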